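(* For a plane closed curve $\Gamma$ with index $i$ and parameters $s,t$, let $$CI_3(\Gamma;s,t)=\big[\,s[XYXYZZ]+t[XXYYZZ],\;w_\Gamma\big]+i .$$ Then $CI_3$ is an invariant of plane closed curves: its value does not depend on the choice of the base point used to form $w_\Gamma$ and is unchanged under plane isotopy.
   Context: Curves are oriented. A plane closed curve is an immersion $S^1\to\mathbf{R}^2$ whose only singular points are transversal double points; a base point is a point of the curve that is not a double point. The index is the rotation (winding) number, i.e. the number of counterclockwise full turns of the tangent vector. For $\Gamma$ with a base point, $w_\Gamma$ is the word obtained by labelling the double points by distinct letters and reading the labels along $\Gamma$ from the base point (each letter occurs twice). If $t_1,t_2$ are the tangent vectors at a double point $A$ on the first and second passage, $\mathrm{sign}\,A=+1$ if $(t_1,t_2)$ is a negatively oriented frame, and $-1$ if positively oriented. For a word $v$ in which each letter occurs exactly twice, $\langle v,w_\Gamma\rangle=\sum_{v'}\prod_{A\in v'}\mathrm{sign}\,A$, the sum over all sub-words $v'$ of $w_\Gamma$ (choose a subset of letters and delete all occurrences of the others) that equal $v$ up to a bijective renaming of letters, the product being over the distinct letters of $v'$; extend linearly in $v$. Put $[\sum_k c_k[v_k],w_\Gamma]=\sum_k c_k\langle[v_k],w_\Gamma\rangle$, where $[XYXYZZ]$ stands for $$XYXYZZ-YXYZZX+XYZZXY-YZZXYX+ZZXYXY-ZXYXYZ$$ and $[XXYYZZ]$ stands for $XXYYZZ-XYYZZX$. *)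

(* Defs.v *)
From HB Require Import structures.
From mathcomp Require Import all_boot all_order all_algebra.
From mathcomp Require Import finmap.
From mathcomp Require Import all_classical all_reals all_analysis.

Set Implicit Arguments.
Unset Strict Implicit.
Unset Printing Implicit Defensive.

Import Order.TTheory GRing.Theory Num.Theory.
Import numFieldNormedType.Exports.

Local Open Scope classical_set_scope.
Local Open Scope ring_scope.

Section Words.
Variables (T : choiceType) (sg : T -> int).

Definition same_up_to_renaming (v : seq nat) (w : seq T) : Prop :=
  exists2 f : nat -> T, {in v &, injective f} & map f v = w.

(* <v, w>: sub-words of w correspond to sets S of letters that are kept. *)
Definition pairing (v : seq nat) (w : seq T) : int :=
  \sum_(S <- fpowerset [fset x in w]%fset
        | `[< same_up_to_renaming v [seq x <- w | x \in S] >])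
     \prod_(A <- S) sg A.

Definition pairing_lin (c : seq (int * seq nat)) (w : seq T) : int :=
  \sum_(p <- c) p.1 * pairing p.2 w.

End Words.

Local Notation X := 0%N.
Local Notation Y := 1%N.
Local Notation Z := 2%N.

Definition bracket_XYXYZZ : seq (int * seq nat) :=
  [:: (  1, [:: X; Y; X; Y; Z; Z]);
      (- 1, [:: Y; X; Y; Z; Z; X]);
      (  1, [:: X; Y; Z; Z; X; Y]);
      (- 1, [:: Y; Z; Z; X; Y; X]);
      (  1, [:: Z; Z; X; Y; X; Y]);
      (- 1, [:: Z; X; Y; X; Y; Z])].

Definition bracket_XXYYZZ : seq (int * seq nat) :=
  [:: (  1, [:: X; X; Y; Y; Z; Z]);
      (- 1, [:: X; Y; Y; Z; Z; X])].

Section Curves.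
Variable R : realType.

Local Notation plane := 'rV[R]_2.

Definition frame_det (u v : plane) : R := \det (col_mx u v : 'M[R]_2).

(* The circle is R/Z: a closed curve is a 1-periodic map R -> plane, and two
   parameters represent the same point of the circle when congruent mod 1. *)
Definition same_circle_point (t u : R) : Prop := t - u \is a Num.int.

Definition double_param (g : R -> plane) (t : R) : Prop :=
  exists2 u : R, ~ same_circle_point t u & g t = g u.

Record plane_closed_curve (g : R -> plane) : Prop := PlaneClosedCurve {
  curve_periodic : forall t, g (t + 1) = g t;
  curve_derivable : forall t, derivable g t 1;
  curve_C1 : continuous (derive1 g);
  curve_immersion : forall t, derive1 g t != 0;
  curve_no_triple_point : forall t u v, g t = g u -> g u = g v ->
    [\/ same_circle_point t u, same_circle_point u v | same_circle_point t v];
  curve_transversal : forall t u, ~ same_circle_point t u -> g t = g u ->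
    frame_det (derive1 g t) (derive1 g u) != 0 }.

Definition base_point (g : R -> plane) (b : R) : Prop := ~ double_param g b.

(* For a plane closed curve this set of parameters is finite, by compactness
   and transversality, so that fset_set enumerates it. *)
Definition passages (g : R -> plane) (b : R) : seq R :=
  sort <=%R (fset_set [set t | b <= t < b + 1 /\ double_param g t]).

(* Each double point is used as its own label. *)
Definition gauss_word (g : R -> plane) (b : R) : seq plane :=
  map g (passages g b).

(* +1 on negatively oriented frames *)
Definition double_point_sign (g : R -> plane) (b : R) (A : plane) : int :=
  let p := [seq t <- passages g b | g t == A] in
  - sgz (frame_det (derive1 g (nth 0 p 0)) (derive1 g (nth 0 p 1))).

Definition direction (a : R) : plane :=
  \row_(j < 2) if j == 0 then cos a else sin a.

Definition has_index (g : R -> plane) (i : int) : Prop :=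
  exists theta r : R -> R,
    [/\ continuous theta,
        forall t, 0 < r t,
        forall t, derive1 g t = r t *: direction (theta t) &
        theta 1 - theta 0 = 2 * pi * i%:~R].

Definition rotation_index (g : R -> plane) : int := xget 0 [set i | has_index g i].

Definition CI3 (s t : R) (g : R -> plane) (b : R) : R :=
  let w := gauss_word g b in
  let sg := double_point_sign g b in
  s * (pairing_lin sg bracket_XYXYZZ w)%:~R
  + t * (pairing_lin sg bracket_XXYYZZ w)%:~R
  + (rotation_index g)%:~R.

Definition C1_map (f : plane -> plane) : Prop :=
  (forall x, differentiable f x) /\ continuous (jacobian f).

Definition C1_diffeo (f : plane -> plane) : Prop :=
  exists f' : plane -> plane,
    [/\ cancel f f', cancel f' f, C1_map f & C1_map f'].

(* H a x is the position of x at time a; only times a in [0, 1] matter. *)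
Record plane_isotopy (H : R -> plane -> plane) : Prop := PlaneIsotopy {
  isotopy_start : H 0 =1 id;
  isotopy_diffeo : forall a, 0 <= a <= 1 -> C1_diffeo (H a);
  isotopy_continuous :
    {within [set p : R * plane | 0 <= p.1 <= 1],
      continuous (fun p : R * plane => H p.1 p.2)};
  isotopy_jacobian_continuous :
    {within [set p : R * plane | 0 <= p.1 <= 1],
      continuous (fun p : R * plane => jacobian (H p.1) p.2)} }.

(* Lift to R of an orientation preserving diffeomorphism of the circle R/Z *)
Record circle_reparam (phi : R -> R) : Prop := CircleReparam {
  reparam_shift : forall t, phi (t + 1) = phi t + 1;
  reparam_derivable : forall t, derivable phi t 1;
  reparam_C1 : continuous (derive1 phi);
  reparam_increasing : forall t, 0 < derive1 phi t }.

(* An ambient isotopy carries the oriented curve g to the oriented curve g',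
   regardless of parametrizations. *)
Definition plane_isotopic (g g' : R -> plane) : Prop :=
  exists (H : R -> plane -> plane) (phi : R -> R),
    [/\ plane_isotopy H, circle_reparam phi &
        forall t, g' t = H 1 (g (phi t))].

End Curves.

(* Main.v *)
Require Import Defs.
From mathcomp Require Import all_boot all_order all_algebra.
From mathcomp Require Import finmap.
From mathcomp Require Import all_classical all_reals all_analysis.
From mathcomp Require Import ring lra zify.

Set Implicit Arguments.
Unset Strict Implicit.
Unset Printing Implicit Defensive.

Import Order.TTheory GRing.Theory Num.Theory.
Import numFieldNormedType.Exports.

Local Open Scope classical_set_scope.
Local Open Scope ring_scope.

(** The number attached to a word is a sum, over the sets S of kept letters, of
    a coefficient of the sub-word w|S times the product of the signs of the
    letters in S.  Each bracket is built so that its coefficient function is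
    alternating: it changes sign when a word is rotated by one letter
    (cyclically_alternating).  When the base point moves past one passage of a
    double point A, the letter A goes from the front of the word to its end,
    and the two tangent vectors at A are met in the opposite order, so that
    the sign of A changes and no other sign does.  Sets S without A contribute
    as before; for sets S with A the two changes of sign cancel
    (pairing_lin_rot).  The index does not involve the base point at all.

    An ambient isotopy H takes g to H 1 o g o phi.  The map phi carries the
    passages of the new curve onto those of the old one in the same order, and
    H 1 renames the letters injectively.  The frame at a double point is
    multiplied by the jacobian matrix of H 1 there, and by positive speeds of
    phi; the determinant of that matrix is positive, since along the isotopy it
    goes from 1 to its final value without vanishing (det_jacobian_gt0).  Hence
    words and signs agree (curve_pairing_transport).

    For the index, the velocities of the curves H a o g o phi_a, with phi_a
    interpolating between the identity and phi, form up to positive factors a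
    homotopy of nowhere zero periodic vector fields along the circle.  Two
    fields that make an acute angle everywhere have the same index: an angle
    function for one is corrected by the arctangent of the angle between them
    (field_index_close).  By compactness of [0, 1] the index is then locally
    constant, and so constant, along a homotopy (field_index_homotopy).

    A set of passages with infinitely many elements is enumerated by the empty
    list.  If there are infinitely many passages in one period, the same holds
    in every period and for every isotopic curve, and the words on both sides
    are empty; the proofs therefore split according to whether the set of
    passages is finite. *)

(** * Alternating combinations of words *)

Section WordCoefficients.
Variable T : choiceType.
Implicit Types (u w : seq T) (c : seq (int * seq nat)) (sg : T -> int).

Definition word_coeff c u : int :=
  \sum_(p <- c) p.1 * (`[< same_up_to_renaming p.2 u >])%:R.

(** Exchanging the two sums isolates the coefficient of each sub-word, which is
    the only place where the combination c enters. *)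
Lemma pairing_linE sg c w :
  pairing_lin sg c w = \sum_(S <- fpowerset [fset x in w]%fset)
     word_coeff c [seq x <- w | x \in S] * \prod_(A <- S) sg A.
Proof.
rewrite /pairing_lin /pairing /word_coeff.
under eq_bigr => p _ do rewrite mulr_sumr.
rewrite (exchange_big_dep xpredT) //=; apply: eq_bigr => S _.
rewrite mulr_suml big_mkcond; apply: eq_bigr => p _ /=.
by case: ifP => _; rewrite ?mulr1 // mulr0 mul0r.
Qed.

Lemma same_up_to_renaming_rot v u :
  same_up_to_renaming (rot 1 v) (rot 1 u) <-> same_up_to_renaming v u.
Proof.
split=> -[f inj_f fv]; exists f.
- by move=> x y xv yv; apply: inj_f; rewrite mem_rot.
- by apply: (@rot_inj 1); rewrite -map_rot.
- by move=> x y; rewrite !mem_rot; apply: inj_f.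
- by rewrite map_rot fv.
Qed.

Lemma same_up_to_renaming_map (h : nat -> nat) v u :
  {in v &, injective h} ->
  same_up_to_renaming (map h v) u -> same_up_to_renaming v u.
Proof.
move=> inj_h [f inj_f fv]; exists (f \o h); last by rewrite map_comp.
by move=> x y xv yv /= /inj_f e; apply: inj_h => //; apply: e; apply: map_f.
Qed.

End WordCoefficients.

Definition cyclically_alternating (c : seq (int * seq nat)) :=
  forall (U : choiceType) (u : seq U), word_coeff c (rot 1 u) = - word_coeff c u.

(** The six words are the successive rotations of XYXYZZ, with alternating
    signs, and a word matches v up to renaming exactly when its rotation matches
    the rotation of v. *)
Lemma alternating_XYXYZZ : cyclically_alternating bracket_XYXYZZ.
Proof.
move=> U u; rewrite /word_coeff /bracket_XYXYZZ !big_cons !big_nil /=.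
have step v : `[< same_up_to_renaming (rot 1 v) (rot 1 u) >]
            = `[< same_up_to_renaming v u >].
  by apply/asbool_equiv_eq/same_up_to_renaming_rot.
rewrite -!step /rot /=; ring.
Qed.

(** Two rotations bring XXYYZZ back to itself after renaming the letters
    cyclically, so that two words suffice. *)
Lemma alternating_XXYYZZ : cyclically_alternating bracket_XXYYZZ.
Proof.
move=> U u; rewrite /word_coeff /bracket_XXYYZZ !big_cons !big_nil /=.
have step v : `[< same_up_to_renaming (rot 1 v) (rot 1 u) >]
            = `[< same_up_to_renaming v u >].
  by apply/asbool_equiv_eq/same_up_to_renaming_rot.
rewrite -!step /rot /=.
(* The second rotation is YYZZXX, which is XXYYZZ under 0 -> 1 -> 2 -> 0. *)
have -> : `[< same_up_to_renaming [:: 1; 1; 2; 2; 0; 0]%N (drop 1 u ++ take 1 u) >]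
  = `[< same_up_to_renaming [:: 0; 0; 1; 1; 2; 2]%N (drop 1 u ++ take 1 u) >].
  apply: asbool_equiv_eq; split.
    apply: (@same_up_to_renaming_map _ (fun n => (n.+1 %% 3)%N) [:: 0; 0; 1; 1; 2; 2]%N).
    by move=> x y; rewrite !inE => /or4P[||| /or3P[]] /eqP-> /or4P[||| /or3P[]] /eqP->.
  apply: (@same_up_to_renaming_map _ (fun n => (n.+2 %% 3)%N) [:: 1; 1; 2; 2; 0; 0]%N).
  by move=> x y; rewrite !inE => /or4P[||| /or3P[]] /eqP-> /or4P[||| /or3P[]] /eqP->.
ring.
Qed.

(** The effect of moving the base point past one passage of A.  A set of
    letters that contains A sees its sub-word rotated and the sign of A
    reversed; a set that does not contain A sees no change. *)
Lemma pairing_lin_rot (T : choiceType) (sg sg' : T -> int) c A u : cyclically_alternating c ->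
    sg' A = - sg A -> (forall B, B != A -> sg' B = sg B) ->
  pairing_lin sg' c (rcons u A) = pairing_lin sg c (A :: u).
Proof.
move=> altc sgA sgB; rewrite !pairing_linE.
have -> : [fset x in rcons u A]%fset = [fset x in A :: u]%fset.
  by apply/fsetP => x; rewrite !inE mem_rcons.
apply: eq_bigr => S _; rewrite filter_rcons /=; case: ifP => AS.
  rewrite -rot1_cons altc !(big_fsetD1 _ AS) /= sgA !mulNr mulrN opprK.
  congr (_ * (_ * _)); rewrite big_seq [RHS]big_seq; apply: eq_bigr => B.
  by rewrite !inE => /andP[+ _]; apply: sgB.
congr (_ * _); rewrite big_seq [RHS]big_seq; apply: eq_bigr => B BS.
by apply: sgB; apply: contraFneq AS => <-.
Qed.

(** A left inverse g of f serves to turn a renaming onto sub-words of map f w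
    back into a renaming with values in T1. *)
Lemma pairing_map (T1 T2 : choiceType) (f : T1 -> T2) (g : T2 -> T1) sg1 sg2 v
    (w : seq T1) :
  cancel f g -> {in w, forall A, sg2 (f A) = sg1 A} ->
  pairing sg2 v (map f w) = pairing sg1 v w.
Proof.
move=> fK sgf; have inj_f := can_inj fK; rewrite /pairing.
have img_inj : injective (fun S : {fset T1} => [fset f x | x in S]%fset).
  move=> S1 S2 /fsetP e; apply/fsetP => x.
  by have := e (f x); rewrite !mem_imfset.
rewrite (perm_big [seq [fset f x | x in B]%fset
                  | B : {fset T1} <- fpowerset [fset x in w]%fset]); last first.
  apply: uniq_perm => [||S2]; first exact: fset_uniq.
    by rewrite map_inj_uniq // fset_uniq.
  rewrite fpowersetE; apply/fsubsetP/mapP => [sS|[S1]].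
    exists [fset x in w | f x \in S2]%fset.
      by rewrite fpowersetE; apply/fsubsetP => x; rewrite !inE => /andP[].
    apply/fsetP => y; apply/idP/imfsetP => [yS|[x]]; last first.
      by rewrite !inE => /andP[_ +] ->.
    have := sS _ yS; rewrite inE => /mapP[x xw yx]; exists x => //.
    by rewrite !inE xw /= -yx.
  rewrite fpowersetE => /fsubsetP sS -> y /imfsetP[x /= /sS xw ->].
  by move: xw; rewrite !inE; apply: map_f.
rewrite big_map big_seq_cond [RHS]big_seq_cond.
have same S : [seq x <- map f w | x \in [fset f x | x in S]%fset]
     = map f [seq x <- w | x \in S].
  rewrite filter_map; congr map; apply: eq_filter => x /=.
  by rewrite mem_imfset.
have same_renaming u : same_up_to_renaming v (map f u) <->
    same_up_to_renaming v u.
  split=> [[h inj_h hv]|[h inj_h hv]]; last first.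
    exists (f \o h); last by rewrite map_comp hv.
    by move=> x y xv yv /= /inj_f; apply: inj_h.
  exists (g \o h); last by rewrite map_comp hv mapK.
  have hP n : n \in v -> f (g (h n)) = h n.
    by move=> nv; have /mapP[x _ ->] : h n \in map f u; rewrite ?fK // -hv map_f.
  by move=> x y xv yv /= e; apply: inj_h; rewrite // -hP // e hP.
apply: eq_big => [S|S].
  by rewrite same; congr (_ && _); apply: asbool_equiv_eq.
move=> /andP[+ _]; rewrite fpowersetE => /fsubsetP sS.
rewrite big_imfset /=; last by move=> x y _ _ /inj_f.
rewrite big_seq [RHS]big_seq; apply: eq_bigr => x /sS; rewrite inE.
exact: sgf.
Qed.

(** * Moving the base point *)

Section Passages.
Variable R : realType.
Local Notation plane := 'rV[R]_2.
Implicit Types (g : R -> plane) (b t u : R) (c : seq (int * seq nat)).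

Lemma det_mx22 (M : 'M[R]_2) : \det M = M 0 0 * M 1 1 - M 0 1 * M 1 0.
Proof.
rewrite (expand_det_row _ 0) !big_ord_recl big_ord0 addr0.
rewrite /cofactor !det_mx11 !mxE /= expr0 expr1 mul1r mulN1r mulrN.
by congr (_ * M _ _ - M _ _ * M _ _); apply: val_inj.
Qed.

Lemma frame_detE (u v : plane) : frame_det u v = u 0 0 * v 0 1 - u 0 1 * v 0 0.
Proof.
rewrite /frame_det det_mx22 !mxE.
by do 4 (case: splitP => k; rewrite (ord1 k) // => _ {k}).
Qed.

Lemma passages_eq g b s : sorted <%R s ->
    (forall t, t \in s <-> (b <= t < b + 1 /\ double_param g t)) ->
  passages g b = s.
Proof.
move=> sorted_s memP; rewrite /passages.
have -> : [set t | b <= t < b + 1 /\ double_param g t] = [set` s].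
  by apply/seteqP; split => t /= /memP.
apply: lt_sorted_eq => //; first by rewrite sort_lt_sorted fset_uniq.
move=> t; rewrite mem_sort; apply/idP/idP => [|ts].
  by rewrite in_fset_set ?inE //; exact: finite_seq.
by rewrite in_fset_set ?inE //; exact: finite_seq.
Qed.

Lemma mem_passages g b t :
    finite_set [set u | b <= u < b + 1 /\ double_param g u] ->
  t \in passages g b <-> (b <= t < b + 1 /\ double_param g t).
Proof. by move=> fin; rewrite mem_sort in_fset_set // inE. Qed.

Lemma sorted_passages g b : sorted <%R (passages g b).
Proof. by rewrite sort_lt_sorted fset_uniq. Qed.

Lemma passages_infinite g b :
    ~ finite_set [set u | b <= u < b + 1 /\ double_param g u] ->
  passages g b = [::].
Proof. by move=> inf; rewrite /passages /fset_set; case: pselect. Qed.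

Lemma same_circle_pointP t u :
  same_circle_point t u <-> exists n : int, t = u + n%:~R.
Proof.
split=> [/intrP[n tu]|[n ->]]; first by exists n; rewrite -tu; ring.
by apply/intrP; exists n; ring.
Qed.

Lemma same_circle_point_sym t u : same_circle_point t u -> same_circle_point u t.
Proof. by rewrite /same_circle_point -opprB rpredN. Qed.

Lemma same_circle_point_eq b t u :
  b <= t < b + 1 -> b <= u < b + 1 -> same_circle_point t u -> t = u.
Proof.
move=> tb ub /same_circle_pointP[n tun].
suff n0 : n = 0 by rewrite tun n0 addr0.
have : (-1)%:~R < n%:~R :> R by lra.
have : n%:~R < 1%:~R :> R by lra.
by rewrite !ltr_int; lia.
Qed.

Lemma same_circle_point_fundamental b u :
  exists2 v, b <= v < b + 1 & same_circle_point u v.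
Proof.
exists (u - (Num.floor (u - b))%:~R).
  have /andP[] := real_floor_itv (num_real (u - b)).
  by rewrite intrD; lra.
by apply/same_circle_pointP; exists (Num.floor (u - b)); ring.
Qed.

Section Periodic.
Variable g : R -> plane.
Hypothesis periodic_g : forall t, g (t + 1) = g t.

Lemma periodic_int t (n : int) : g (t + n%:~R) = g t.
Proof.
have nat_case k u : g (u + k%:R) = g u.
  elim: k => [|k IHk]; first by rewrite addr0.
  by rewrite -natr1 addrA periodic_g.
case: n => k; first exact: nat_case.
by rewrite -(nat_case k.+1 (t + _)) NegzE -addrA; congr g; rewrite intrN; ring.
Qed.

Lemma periodic_same_circle t u : same_circle_point t u -> g t = g u.
Proof. by move=> /same_circle_pointP[n ->]; apply: periodic_int. Qed.

Lemma derive1_periodic t : derive1 g (t + 1) = derive1 g t.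
Proof.
rewrite /derive1; set d := (fun _ : R => _); set d' := (fun _ : R => _).
suff -> : d = d' by [].
apply/funext => h; rewrite /d /d' /=.
by rewrite addrA !periodic_g.
Qed.

Lemma double_param_same_circle t u :
  same_circle_point t u -> double_param g t -> double_param g u.
Proof.
move=> tu [v tv gtv]; exists v; last by rewrite -(periodic_same_circle tu).
move=> uv; apply: tv; rewrite /same_circle_point.
have -> : t - v = (t - u) + (u - v) by ring.
exact: rpredD.
Qed.

End Periodic.

(** Signs are read off an arbitrary list of parameters, so that the base point
    can be moved one passage at a time through lists which need not be sorted
    or start at a prescribed parameter. *)
Definition list_sign g (p : seq R) (A : plane) : int :=
  let q := [seq t <- p | g t == A] in
  - sgz (frame_det (derive1 g (nth 0 q 0)) (derive1 g (nth 0 q 1))).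

Definition list_pairing g c (p : seq R) : int :=
  pairing_lin (list_sign g p) c (map g p).

Section ClosedCurve.
Variable g : R -> plane.
Hypothesis curve_g : plane_closed_curve g.
Let periodic_g := curve_periodic curve_g.

Definition twice (p : seq R) :=
  forall t, t \in p -> count (fun x => g x == g t) p = 2.

(** A double point has a second passage in each period, and only one since
    there are no triple points. *)
Lemma twice_passages b :
    finite_set [set u | b <= u < b + 1 /\ double_param g u] ->
  twice (passages g b).
Proof.
move=> fin t /(mem_passages _ fin)[tb] Dt; have [u tu gtu] := Dt.
have [v vb uv] := same_circle_point_fundamental b u.
have gtv : g t = g v by rewrite gtu (periodic_same_circle periodic_g uv).
have tv : ~ same_circle_point t v.
  move=> tv; apply: tu; rewrite /same_circle_point.
  by have -> : t - u = (t - v) - (u - v) by [ring]; rewrite rpredB.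
have Dv : double_param g v.
  by exists t => // /same_circle_point_sym.
rewrite -size_filter; apply: (@perm_size _ _ [:: t; v]); apply: uniq_perm.
- by rewrite filter_uniq // sort_uniq fset_uniq.
- rewrite /= andbT inE; apply/eqP => e.
  by apply: tv; rewrite e /same_circle_point subrr.
move=> x; rewrite mem_filter !inE; apply/andP/orP => [[/eqP gxt]|].
  move/(mem_passages _ fin) => [xb _].
  have := curve_no_triple_point curve_g gxt gtv.
  case=> [xt|//|xv]; [left|right]; apply/eqP;
    exact: same_circle_point_eq xb _ _.
case=> /eqP ->; split; rewrite ?gtv ?eqxx //; first exact/(mem_passages _ fin).
exact/(mem_passages _ fin).
Qed.

(** The first passage t reappears one period later at the end; its tangent is
    then the second vector of the frame, so that the frame determinant at the
    double point changes sign. *)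
Lemma list_pairing_step c t s : cyclically_alternating c -> twice (t :: s) ->
  list_pairing g c (t :: s) = list_pairing g c (rcons s (t + 1)).
Proof.
move=> altc twice_s; rewrite /list_pairing map_rcons periodic_g /=; symmetry.
have := twice_s t (mem_head _ _); rewrite /= eqxx add1n => -[].
rewrite -size_filter => size_q.
apply: pairing_lin_rot => [//||B]; rewrite /list_sign filter_rcons periodic_g /=.
  rewrite eqxx; case: [seq x <- s | _] size_q => [//|u [|//]] _ /=.
  rewrite derive1_periodic //; congr (- _); rewrite -sgzN !frame_detE opprB.
  by congr (sgz (_ - _)); rewrite mulrC.
by rewrite eq_sym => /negPf ->.
Qed.

Lemma list_pairing_move c s1 s2 : cyclically_alternating c -> twice (s1 ++ s2) ->
  list_pairing g c (s1 ++ s2) =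
  list_pairing g c (s2 ++ [seq t + 1 | t <- s1]).
Proof.
move=> altc; elim: s1 s2 => [|t s1 IHs] s2 twice_s /=; first by rewrite cats0.
rewrite (list_pairing_step altc twice_s) rcons_cat IHs.
  by rewrite -cats1 -catA.
rewrite -rcons_cat.
move=> u; rewrite -cats1 count_cat /= addn0 periodic_g mem_cat inE.
rewrite addnC -[(_ + _)%N]/(count (fun x => g x == g u) (t :: s1 ++ s2)).
move=> /orP[us|/eqP ->]; last by rewrite periodic_g twice_s // mem_head.
by rewrite twice_s // inE us orbT.
Qed.

Definition curve_pairing c b :=
  pairing_lin (double_point_sign g b) c (gauss_word g b).

(** The passages in [b, b + 1[ split at b' into s1 and s2; those in
    [b', b' + 1[ are s2 followed by the translate of s1. *)
Lemma curve_pairing_window c b b' : cyclically_alternating c -> b <= b' <= b + 1 ->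
  curve_pairing c b = curve_pairing c b'.
Proof.
move=> altc bb'.
have Dshift t : double_param g (t + 1) <-> double_param g t.
  have tt1 : same_circle_point (t + 1) t.
    by apply/same_circle_pointP; exists 1.
  split; apply: double_param_same_circle => //.
  exact: same_circle_point_sym.
have [fin|inf] := pselect (finite_set [set u | b <= u < b + 1 /\ double_param g u]).
  pose s1 := [seq t <- passages g b | t < b'].
  pose s2 := [seq t <- passages g b | b' <= t].
  have mem_s1 t : t \in s1 <-> [/\ b <= t < b', double_param g t & t < b + 1].
    rewrite mem_filter; split=> [/andP[tb' /(mem_passages _ fin)[tb Dt]]|[tb Dt tb1]].
      by split=> //; lra.
    apply/andP; split; first lra.
    by apply/(mem_passages _ fin); split=> //; lra.
  have mem_s2 t : t \in s2 <-> b' <= t < b + 1 /\ double_param g t.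
    rewrite mem_filter; split=> [/andP[tb' /(mem_passages _ fin)[tb Dt]]|[tb Dt]].
      by split=> //; lra.
    apply/andP; split; first lra.
    by apply/(mem_passages _ fin); split=> //; lra.
  have sorted1 : sorted <%R s1.
    by apply: sorted_filter; [exact: lt_trans | exact: sorted_passages].
  have sorted2 : sorted <%R s2.
    by apply: sorted_filter; [exact: lt_trans | exact: sorted_passages].
  have pb : passages g b = s1 ++ s2.
    apply: passages_eq => [|t].
      rewrite (sorted_pairwise lt_trans) pairwise_cat -!(sorted_pairwise lt_trans).
      rewrite sorted1 sorted2 !andbT; apply/allrelP => x y /mem_s1[? _ _] /mem_s2[? _].
      lra.
    rewrite mem_cat; split=> [/orP[/mem_s1[? ? ?]|/mem_s2[? ?]]|[? Dt]].
    - by split=> //; lra.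
    - by split=> //; lra.
    apply/orP; have [tb'|tb'] := ltP t b'.
      by left; apply/mem_s1; split=> //; lra.
    by right; apply/mem_s2; split=> //; lra.
  have pb' : passages g b' = s2 ++ [seq t + 1 | t <- s1].
    apply: passages_eq => [|t].
      rewrite (sorted_pairwise lt_trans) pairwise_cat -!(sorted_pairwise lt_trans).
      rewrite sorted2 sorted_map /=.
      rewrite (eq_sorted (e' := <%R)) ?sorted1 ?andbT => [|x y]; last first.
        by rewrite /= ltrD2r.
      apply/allrelP => x _ /mem_s2[? _] /mapP[y /mem_s1[? _ _] ->].
      lra.
    rewrite mem_cat; split.
      move=> /orP[/mem_s2[? ?]|/mapP[y /mem_s1[? ? ?] ->]].
        by split=> //; lra.
      by split; [lra | exact/Dshift].
    move=> [? Dt]; apply/orP; have [tb'|tb'] := ltP t (b + 1).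
      by left; apply/mem_s2; split=> //; lra.
    right; apply/mapP; exists (t - 1); last by rewrite subrK.
    by apply/mem_s1; split; [lra | apply/Dshift; rewrite subrK | lra].
  rewrite [LHS]/(list_pairing g c (passages g b)).
  rewrite [RHS]/(list_pairing g c (passages g b')).
  by rewrite pb pb'; apply: list_pairing_move => //; rewrite -pb; apply: twice_passages.
have inf' : ~ finite_set [set u | b' <= u < b' + 1 /\ double_param g u].
  move=> fin'; apply: inf.
  apply: (@sub_finite_set _ _
      ([set u | b' <= u < b' + 1 /\ double_param g u] `|`
       (fun u => u - 1) @` [set u | b' <= u < b' + 1 /\ double_param g u])).
    move=> t /= [tb Dt]; have [tb'|tb'] := ltP t b'; [right|left].
      exists (t + 1); last by rewrite addrK.
      by split; [lra | exact/Dshift].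
    by split=> //; lra.
  by rewrite finite_setU; split=> //; apply: finite_image.
rewrite /curve_pairing /gauss_word.
by rewrite /double_point_sign !passages_infinite.
Qed.

(** Windows of length one reach every base point: b + n is reached from b by n
    whole periods, with n the integral part of b' - b. *)
Lemma curve_pairing_base c b b' : cyclically_alternating c ->
  curve_pairing c b = curve_pairing c b'.
Proof.
move=> altc; wlog bb' : b b' / b <= b'.
  by move=> base; have [/base //|/ltW/base ->] := leP b b'.
have shift n : curve_pairing c (b + n%:R) = curve_pairing c b.
  elim: n => [|n <-]; first by rewrite addr0.
  by symmetry; apply: curve_pairing_window; rewrite // -natr1; lra.
rewrite -(shift (Num.trunc (b' - b))).
apply: curve_pairing_window => //.
have /truncn_itv : 0 <= b' - b by rewrite subr_ge0.
by rewrite -natr1; lra.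
Qed.

End ClosedCurve.
End Passages.

(** * The index of a field of vectors along the circle *)

Section Plane.
Variable R : realType.
Local Notation plane := 'rV[R]_2.

Lemma plane_eqP (u v : plane) : u 0 0 = v 0 0 -> u 0 1 = v 0 1 -> u = v.
Proof.
move=> e0 e1; apply/rowP; case; case => [|[|//]] i.
  by rewrite (_ : Ordinal i = 0) //; apply: val_inj.
by rewrite (_ : Ordinal i = 1) //; apply: val_inj.
Qed.

Definition dot (u v : plane) : R := u 0 0 * v 0 0 + u 0 1 * v 0 1.

Lemma dot_gt0 u : u != 0 -> 0 < dot u u.
Proof.
move=> u0; rewrite /dot -!expr2 lt_neqAle addr_ge0 ?sqr_ge0 // andbT.
apply: contraNneq u0 => /esym/eqP; rewrite paddr_eq0 ?sqr_ge0 // !sqrf_eq0.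
by move=> /andP[/eqP u0 /eqP u1]; apply/eqP/plane_eqP; rewrite mxE.
Qed.

Lemma direction0 (a : R) : direction a 0 0 = cos a. Proof. by rewrite mxE. Qed.
Lemma direction1 (a : R) : direction a 0 1 = sin a. Proof. by rewrite mxE. Qed.

(** Used to see that an angle function for a periodic field has periodic cosine
    and sine. *)
Lemma polar_inj (r r' a a' : R) : 0 < r -> 0 < r' ->
  r *: direction a = r' *: direction a' -> direction a = direction a'.
Proof.
move=> r0 r'0 e.
have e0 : r * cos a = r' * cos a'.
  by have := congr1 (fun v : plane => v 0 0) e; rewrite /= !mxE.
have e1 : r * sin a = r' * sin a'.
  by have := congr1 (fun v : plane => v 0 1) e; rewrite /= !mxE.
have rr' : r = r'.
  apply/eqP; rewrite -(@eqrXn2 _ 2) ?ltW //; apply/eqP.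
  rewrite -[r ^+ 2]mulr1 -(cos2Dsin2 a) -[r' ^+ 2]mulr1 -(cos2Dsin2 a').
  by rewrite !mulrDr -!exprMn e0 e1.
by move: e; rewrite rr' => /(scalerI (lt0r_neq0 r'0)).
Qed.

(** The index of a curve is the case V = derive1 g; a homotopy leaves the class
    of velocity fields, hence the more general form. *)
Definition field_index (V : R -> plane) (i : int) : Prop :=
  exists theta r : R -> R,
    [/\ continuous theta,
        forall t, 0 < r t,
        forall t, V t = r t *: direction (theta t) &
        theta 1 - theta 0 = 2 * pi * i%:~R].

Lemma field_index_scale (c : R -> R) V i : (forall t, 0 < c t) ->
  field_index V i <-> field_index (fun t => c t *: V t) i.
Proof.
move=> c0; split=> -[theta [r [ctheta r0 Ve dtheta]]].
  exists theta, (fun t => c t * r t); split=> // t; first by rewrite mulr_gt0.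
  by rewrite Ve scalerA.
exists theta, (fun t => (c t)^-1 * r t); split=> // t.
  by rewrite mulr_gt0 ?invr_gt0.
by rewrite -scalerA -Ve scalerA mulVf ?scale1r // gt_eqF.
Qed.

(** Let theta be an angle function for V.  In the moving frame of direction
    theta t, the vector W t has coordinates (D t, E t) with 0 < D t, so that
    theta + atan (E / D) is an angle function for W; the correction is periodic
    and does not affect the total variation of the angle. *)
Lemma field_index_close (V W : R -> plane) i :
    (forall j, continuous (fun t => W t 0 j)) -> V 1 = V 0 -> W 1 = W 0 ->
    (forall t, 0 < dot (V t) (W t)) ->
  field_index V i -> field_index W i.
Proof.
move=> cW V10 W10 VW [theta [r [ctheta r0 Ve dtheta]]].
pose D t := cos (theta t) * W t 0 0 + sin (theta t) * W t 0 1.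
pose E t := cos (theta t) * W t 0 1 - sin (theta t) * W t 0 0.
have D0 t : 0 < D t.
  have : dot (V t) (W t) = r t * D t.
    by rewrite /dot Ve /D !mxE /=; ring.
  by have := VW t => + e; rewrite e pmulr_rgt0.
pose delta t := atan (E t / D t).
have cdelta t : 0 < cos (delta t).
  by apply: cos_gt0_pihalf; rewrite atan_gtNpi2 atan_ltpi2.
exists (fun t => theta t + delta t), (fun t => D t / cos (delta t)); split.
- have ccos : continuous (fun t => cos (theta t)).
    by move=> t; apply: (continuous_comp (ctheta t)); apply: continuous_cos.
  have csin : continuous (fun t => sin (theta t)).
    by move=> t; apply: (continuous_comp (ctheta t)); apply: continuous_sin.
  move=> t; apply: cvgD; first exact: ctheta.
  apply: (continuous_comp (f := fun t => E t / D t)); last exact: continuous_atan.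
  apply: cvgM.
    by apply: cvgB; apply: cvgM; (exact: ccos || exact: csin || exact: cW).
  apply: cvgV; first by rewrite gt_eqF.
  by apply: cvgD; apply: cvgM; (exact: ccos || exact: csin || exact: cW).
- by move=> t; rewrite divr_gt0.
- move=> t.
  have Ecos : D t / cos (delta t) * sin (delta t) = E t.
    have := atanK (E t / D t); rewrite -/(delta t) /tan => e.
    by rewrite -mulrA [_^-1 * _]mulrC e mulrC divfK // gt_eqF.
  have Dcos : D t / cos (delta t) * cos (delta t) = D t by rewrite divfK ?gt_eqF.
  have cs := cos2Dsin2 (theta t).
  apply: plane_eqP; rewrite mxE ?direction0 ?direction1 ?cosD ?sinD.
    transitivity (cos (theta t) * (D t / cos (delta t) * cos (delta t))
      - sin (theta t) * (D t / cos (delta t) * sin (delta t))); last by ring.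
    by rewrite Dcos Ecos /D /E -[LHS]mul1r -cs; ring.
  transitivity (sin (theta t) * (D t / cos (delta t) * cos (delta t))
    + cos (theta t) * (D t / cos (delta t) * sin (delta t))); last by ring.
  by rewrite Dcos Ecos /D /E -[LHS]mul1r -cs; ring.
have d10 : direction (theta 1) = direction (theta 0).
  by apply: (@polar_inj (r 1) (r 0)); rewrite -?Ve.
have c10 : cos (theta 1) = cos (theta 0) by rewrite -!direction0 d10.
have s10 : sin (theta 1) = sin (theta 0) by rewrite -!direction1 d10.
rewrite -dtheta /delta /E /D c10 s10 W10; ring.
Qed.

(** Nearby fields of the homotopy make an acute angle, uniformly over the
    compact [0, 1], so that the truth value of index i is locally constant in
    a.  Seen as a real function it has derivative 0 everywhere, and is
    therefore constant. *)
Lemma field_index_homotopy (V : R -> R -> plane) i :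
    (forall j, continuous (fun p : R * R => V p.1 p.2 0 j)) ->
    (forall a t, V a (t + 1) = V a t) -> (forall a t, V a t != 0) ->
  field_index (V 0) i <-> field_index (V 1) i.
Proof.
move=> cV perV V0.
have V10 a : V a 1 = V a 0 by rewrite -[1]add0r perV.
have cVa a j : continuous (fun t => V a t 0 j).
  move=> t; apply: (continuous_comp (f := fun t => (a, t))
    (g := fun p : R * R => V p.1 p.2 0 j)); last exact: cV.
  by apply: (@cvg_pair _ _ _ _ (nbhs a) (nbhs t)); [exact: cvg_cst | exact: cvg_id].
(* The product is positive near (t, a) for each t; compactness gives one
   neighbourhood of a that serves all t in [0, 1], hence all t by periodicity. *)
have close a : \forall a' \near a, forall t, 0 < dot (V a t) (V a' t).
  have : \forall a' \near a, `[0, 1] `<=` [set t | 0 < dot (V a t) (V a' t)].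
    have /compact_near_coveringP cov := @segment_compact R 0 1.
    apply: (cov R (nbhs a) (fun a' t => 0 < dot (V a t) (V a' t))) => t _.
    have : (fun p : R * R => dot (V a p.1) (V p.2 p.1)) @ (t, a) -->
           dot (V a t) (V a t).
      have cV1 j : (fun p : R * R => V a p.1 0 j) @ (t, a) --> V a t 0 j.
        apply: (@cvg_comp _ _ _ fst (fun t => V a t 0 j) _ (nbhs t)).
          exact: cvg_fst.
        exact: cVa.
      have cV2 j : (fun p : R * R => V p.2 p.1 0 j) @ (t, a) --> V a t 0 j.
        apply: (@cvg_comp _ _ _ (fun p : R * R => (p.2, p.1))
          (fun p : R * R => V p.1 p.2 0 j) _ (nbhs (a, t))); last exact: (cV j (a, t)).
        by apply: (@cvg_pair _ _ _ _ (nbhs a) (nbhs t)); [exact: cvg_snd | exact: cvg_fst].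
      by apply: cvgD; apply: cvgM.
    by move=> /cvgr_gt; apply; apply: dot_gt0.
  apply: filterS => a' pos t.
  have [u ub /same_circle_pointP[n ->]] := same_circle_point_fundamental 0 t.
  rewrite !periodic_int //; apply: pos => /=.
  by rewrite in_itv /=; lra.
pose f (a : R) : R := (`[< field_index (V a) i >])%:R.
have df (a : R) : is_derive a 1 f 0.
  apply: (@near_eq_is_derive _ _ _ (cst (f a))).
  apply: filterS (close a) => a' pos; rewrite /f; congr (_%:R).
  congr (nat_of_bool _); apply: asbool_equiv_eq; split.
    by apply: field_index_close.
  apply: field_index_close => // t.
  by have := pos t; rewrite /dot mulrC [X in _ + X]mulrC.
have e : `[< field_index (V 0) i >] = `[< field_index (V 1) i >].
  have := is_derive_0_is_cst 0 1 df; rewrite /f.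
  by do 2 case: `[< _ >] => //; move=> /eqP; rewrite ?oner_eq0 // eq_sym oner_eq0.
by split=> /asboolP; [rewrite e | rewrite -e] => /asboolP.
Qed.

End Plane.

(** * Diffeomorphisms and isotopies *)

Section Isotopy.
Variable R : realType.
Local Notation plane := 'rV[R]_2.

Lemma jacobian_id (x : plane) : jacobian id x = 1%:M.
Proof.
by apply/row_matrixP => i; rewrite !rowE mul_rV_lin1 diff_val // mulmx1.
Qed.

Lemma jacobian_comp (f h : plane -> plane) x :
    differentiable f x -> differentiable h (f x) ->
  jacobian (h \o f) x = jacobian f x *m jacobian h (f x).
Proof.
move=> df dh; apply/row_matrixP => i.
rewrite rowE mul_rV_lin1 rowE mulmxA mul_rV_lin1 mul_rV_lin1.
exact: (congr1 (fun L : plane -> plane => L _) (diff_comp df dh)).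
Qed.

Lemma det_jacobian_diffeo (f : plane -> plane) x :
  C1_diffeo f -> \det (jacobian f x) != 0.
Proof.
move=> [f' [fK _ [df _] [df' _]]].
have : jacobian f x *m jacobian f' (f x) = 1%:M.
  rewrite -jacobian_comp // (_ : f' \o f = id) ?jacobian_id //.
  by apply/funext.
by move=> /mulmx1_unit[+ _]; rewrite unitmxE unitfE.
Qed.

Lemma derive1_transport (f : plane -> plane) (g : R -> plane) (phi : R -> R) t :
    differentiable f (g (phi t)) -> derivable g (phi t) 1 -> derivable phi t 1 ->
  derive1 (fun t => f (g (phi t))) t =
  derive1 phi t *: (derive1 g (phi t) *m jacobian f (g (phi t))).
Proof.
move=> df /derivable1_diffP dg /derivable1_diffP dphi.
have dgphi : differentiable (g \o phi) t by exact: differentiable_comp.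
rewrite derive1E'; last exact: (differentiable_comp dgphi df).
rewrite (diff_comp dgphi df) /= (diff_comp dphi dg) /=.
rewrite !derive1E' // -mul_rV_lin1 scalemxAl; congr (_ *m _).
by rewrite -[in RHS]linearZ /= -[_ *: 1]/(_ * 1) mulr1.
Qed.

Lemma unit_itv1 : 0 <= (1 : R) <= 1.
Proof. by rewrite ler01 lexx. Qed.

(** Precomposing the time with this retraction of R onto [0, 1] turns
    continuity within [0, 1] into continuity on R. *)
Definition clamp (a : R) : R := Num.max 0 (Num.min 1 a).

Lemma clamp0 : clamp 0 = 0.
Proof. by rewrite /clamp min_r // max_l. Qed.

Lemma clamp1 : clamp 1 = 1.
Proof. by rewrite /clamp min_l // max_r. Qed.

Lemma clamp_itv a : 0 <= clamp a <= 1.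
Proof. by rewrite /clamp le_max lexx ge_max ler01 ge_min lexx. Qed.

Lemma continuous_clamp : continuous clamp.
Proof.
move=> a; apply: continuous_max; first exact: cvg_cst.
by apply: continuous_min; [exact: cvg_cst | exact: cvg_id].
Qed.

Section Motion.
Variable H : R -> plane -> plane.
Hypothesis isotopy_H : plane_isotopy H.

Lemma continuous_jacobian_clamp k j :
  continuous (fun p : R * plane => jacobian (H (clamp p.1)) p.2 k j).
Proof.
move=> p.
have /subspace_continuousP cJ := isotopy_jacobian_continuous isotopy_H.
have cc : (fun p : R * plane => (clamp p.1, p.2)) @ p -->
    within [set p : R * plane | 0 <= p.1 <= 1] (nbhs (clamp p.1, p.2)).
  have c2 : (fun p : R * plane => (clamp p.1, p.2)) @ p --> (clamp p.1, p.2).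
    apply: (@cvg_pair _ _ _ _ (nbhs (clamp p.1)) (nbhs p.2)); last exact: cvg_snd.
    apply: (@cvg_comp _ _ _ fst clamp _ (nbhs p.1)); first exact: cvg_fst.
    exact: continuous_clamp.
  move=> U /c2 cU; apply: filterS (cU : nbhs p (fun q : R * plane =>
    0 <= clamp q.1 <= 1 -> U (clamp q.1, q.2))) => q; apply; exact: clamp_itv.
apply: (cvg_comp _ (fun q : R * plane => jacobian (H q.1) q.2 k j) cc).
apply: (cvg_comp _ (fun M : 'M[R]_2 => M k j)
  (cJ (clamp p.1, p.2) (clamp_itv p.1))).
exact: coord_continuous.
Qed.

(** By the intermediate value theorem: the determinant is 1 at time 0, is
    continuous in time, and never vanishes since each H a is a
    diffeomorphism. *)
Lemma det_jacobian_gt0 x : 0 < \det (jacobian (H 1) x).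
Proof.
pose D a := \det (jacobian (H (clamp a)) x).
have D0 a : D a != 0.
  by apply: det_jacobian_diffeo; apply: isotopy_diffeo; rewrite ?clamp_itv.
have cJ k j : continuous (fun a => jacobian (H (clamp a)) x k j).
  move=> a; apply: (@continuous_comp _ _ _ (fun a => (a, x))
    (fun p : R * plane => jacobian (H (clamp p.1)) p.2 k j)).
    by apply: (@cvg_pair _ _ _ _ (nbhs a) (nbhs x)); [exact: cvg_id | exact: cvg_cst].
  exact: continuous_jacobian_clamp.
have cD : continuous D.
  rewrite /D; under eq_fun do rewrite det_mx22.
  by move=> a; apply: cvgB; apply: cvgM; exact: cJ.
have D_start : D 0 = 1.
  rewrite /D clamp0 (_ : H 0 = id) ?jacobian_id ?det1 //.
  by apply/funext; exact: isotopy_start.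
have -> : \det (jacobian (H 1) x) = D 1 by rewrite /D clamp1.
rewrite lt_neqAle eq_sym D0 /=; case: leP => // /ltW D1.
have [||c _ Dc] := @IVT R D 0 1 0 ler01.
- exact: continuous_subspaceT.
- by rewrite D_start ge_min D1 orbT le_max ler01.
by have := D0 c; rewrite Dc eqxx.
Qed.

Variables (g g' : R -> plane) (phi : R -> R).
Hypotheses (curve_g : plane_closed_curve g) (reparam_phi : circle_reparam phi).
Hypothesis g'E : forall t, g' t = H 1 (g (phi t)).

Lemma derive1_isotopic t :
  derive1 g' t = derive1 phi t *: (derive1 g (phi t) *m jacobian (H 1) (g (phi t))).
Proof.
have /funext -> := g'E.
have [_ [_ _ [dH _] _]] := isotopy_diffeo isotopy_H unit_itv1.
apply: derive1_transport; first exact: dH.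
  exact: curve_derivable.
exact: reparam_derivable.
Qed.

(** A single homotopy takes care of the reparametrization and of the isotopy:
    V a t is the velocity of g at phia a t, moved by the differential of H at
    time a.  V 0 is the velocity of g, and V 1 that of g' up to the positive
    factor phi'. *)
Lemma rotation_index_isotopic : rotation_index g = rotation_index g'.
Proof.
rewrite /rotation_index; congr xget; apply/seteqP.
pose phia (a t : R) := t + a * (phi t - t).
pose V a t := derive1 g (phia a t) *m jacobian (H (clamp a)) (g (phia a t)).
have Vj a t j : V a t 0 j = derive1 g (phia a t) 0 0 * jacobian (H (clamp a)) (g (phia a t)) 0 j
   + derive1 g (phia a t) 0 1 * jacobian (H (clamp a)) (g (phia a t)) 1 j.
  rewrite mxE !big_ord_recl big_ord0 addr0.
  by rewrite (_ : lift _ _ = 1) //; apply: val_inj.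
have V0 : V 0 = derive1 g.
  apply/funext => t; rewrite /V /phia mul0r addr0 clamp0 (_ : H 0 = id).
    by rewrite jacobian_id mulmx1.
  by apply/funext; exact: isotopy_start.
have V1 : derive1 g' = (fun t => derive1 phi t *: V 1 t).
  apply/funext => t; rewrite derive1_isotopic /V /phia clamp1 mul1r.
  by rewrite addrC subrK.
have cphi : continuous phi.
  by move=> t; apply/differentiable_continuous/derivable1_diffP;
    exact: reparam_derivable.
have cphia : continuous (fun p : R * R => phia p.1 p.2).
  move=> p; apply: cvgD; first exact: cvg_snd.
  apply: cvgM; first exact: cvg_fst.
  apply: cvgB; last exact: cvg_snd.
  by apply: (cvg_comp _ phi cvg_snd); exact: cphi.
have cg : continuous g.
  by move=> t; apply/differentiable_continuous/derivable1_diffP;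
    exact: curve_derivable.
have cdg j : continuous (fun p : R * R => derive1 g (phia p.1 p.2) 0 j).
  have cdgj : continuous (fun t => derive1 g t 0 j).
    move=> t; apply: (@continuous_comp _ _ _ (derive1 g) (fun v : plane => v 0 j)).
      exact: (curve_C1 curve_g).
    exact: coord_continuous.
  by move=> p; apply: (cvg_comp _ (fun t => derive1 g t 0 j) (cphia p)); apply: cdgj.
have cJ k j : continuous (fun p : R * R => jacobian (H (clamp p.1)) (g (phia p.1 p.2)) k j).
  move=> p; apply: (@continuous_comp _ _ _ (fun p : R * R => (p.1, g (phia p.1 p.2)))
    (fun p : R * plane => jacobian (H (clamp p.1)) p.2 k j)).
    apply: (@cvg_pair _ _ _ _ (nbhs p.1) (nbhs (g (phia p.1 p.2)))).
      exact: cvg_fst.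
    by apply: (cvg_comp _ g (cphia p)); exact: cg.
  exact: continuous_jacobian_clamp.
have index_eq i : field_index (derive1 g) i <-> field_index (derive1 g') i.
  rewrite V1 -field_index_scale; last exact: reparam_increasing.
  rewrite -V0; apply: field_index_homotopy => [j|a t|a t].
  - under eq_fun do rewrite Vj.
    by move=> p; apply: cvgD; apply: cvgM; (exact: cdg || exact: cJ).
  - have -> : V a (t + 1) = derive1 g (phia a t + 1) *m
      jacobian (H (clamp a)) (g (phia a t + 1)).
      rewrite /V (_ : phia a (t + 1) = phia a t + 1) //.
      by rewrite /phia (reparam_shift reparam_phi); ring.
    by rewrite derive1_periodic ?(curve_periodic curve_g) //; exact: curve_periodic.
  have dJ := det_jacobian_diffeo (g (phia a t))
    (isotopy_diffeo isotopy_H (clamp_itv a)).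
  apply/eqP => V_eq0; have /eqP[] := curve_immersion curve_g (phia a t).
  by rewrite -[LHS](mulmxK (_ : jacobian (H (clamp a)) (g (phia a t)) \in unitmx))
    ?unitmxE ?unitfE // -/(V a t) V_eq0 mul0mx.
by split=> i /= /index_eq.
Qed.

End Motion.
End Isotopy.

(** * Transport of words and signs by an isotopy *)

Section Invariance.
Variable R : realType.
Local Notation plane := 'rV[R]_2.

Lemma frame_det_mulmx (u v : plane) (M : 'M[R]_2) :
  frame_det (u *m M) (v *m M) = \det M * frame_det u v.
Proof.
by rewrite /frame_det -mul_col_mx det_mulmx mulrC.
Qed.

Lemma frame_det_scale (c d : R) (u v : plane) :
  frame_det (c *: u) (d *: v) = c * d * frame_det u v.
Proof. by rewrite !frame_detE !mxE; ring. Qed.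

Section Reparam.
Variable phi : R -> R.
Hypothesis reparam_phi : circle_reparam phi.

Lemma continuous_reparam : continuous phi.
Proof.
by move=> t; apply/differentiable_continuous/derivable1_diffP;
  exact: reparam_derivable.
Qed.

Lemma reparam_lt t u : t < u -> phi t < phi u.
Proof.
move=> tu.
have [||c _ phitu] := @MVT R phi (derive1 phi) t u tu.
- move=> x _; rewrite derive1E; apply: derivableP.
  exact: reparam_derivable.
- by apply: continuous_subspaceT; exact: continuous_reparam.
by rewrite -subr_gt0 phitu mulr_gt0 ?subr_gt0 //; exact: reparam_increasing.
Qed.

Lemma reparam_leE : {mono phi : t u / t <= u}.
Proof. exact: le_mono reparam_lt. Qed.

Lemma reparam_ltE : {mono phi : t u / t < u}.
Proof. exact: leW_mono reparam_leE. Qed.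

Lemma reparam_inj : injective phi.
Proof. exact: inc_inj reparam_leE. Qed.

Lemma reparam_int t (n : int) : phi (t + n%:~R) = phi t + n%:~R.
Proof.
have nat_case k u : phi (u + k%:R) = phi u + k%:R.
  elim: k => [|k IHk]; first by rewrite !addr0.
  by rewrite -natr1 addrA (reparam_shift reparam_phi) IHk addrA.
case: n => k; first exact: nat_case.
apply: (addIr k.+1%:R); rewrite -nat_case NegzE intrN.
by rewrite -pmulrn !subrK.
Qed.

Lemma reparam_surj y : exists t, phi t = y.
Proof.
pose n := Num.floor (y - phi 0).
have /andP[ny yn] : n%:~R <= y - phi 0 < (n + 1)%:~R.
  exact: real_floor_itv (num_real _).
have phin (m : int) : phi m%:~R = phi 0 + m%:~R by rewrite -[m%:~R in LHS]add0r reparam_int.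
have nn1 : n%:~R <= (n + 1)%:~R :> R by rewrite ler_int lerDl.
have [||c _ <-] := @IVT R phi n%:~R (n + 1)%:~R y nn1; last by exists c.
  by apply: continuous_subspaceT; exact: continuous_reparam.
by rewrite !phin ge_min le_max; apply/andP; split; apply/orP; [left|right]; lra.
Qed.

Lemma reparam_same_circle t u :
  same_circle_point (phi t) (phi u) <-> same_circle_point t u.
Proof.
split=> /same_circle_pointP[n e]; apply/same_circle_pointP; exists n.
  by apply: reparam_inj; rewrite reparam_int.
by rewrite e reparam_int.
Qed.

Variables (f : plane -> plane) (g g' : R -> plane).
Hypotheses (inj_f : injective f) (g'E : forall t, g' t = f (g (phi t))).

Lemma double_param_transport t : double_param g' t <-> double_param g (phi t).
Proof.
split=> -[u tu]; last first.
  move: tu; have [v <-] := reparam_surj u => tv gtv.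
  by exists v; [move/reparam_same_circle | rewrite !g'E gtv].
rewrite !g'E => /inj_f e; exists (phi u) => //.
by move/reparam_same_circle.
Qed.

(** The lift phi is an increasing bijection that commutes with the translation
    by 1, hence it maps [b, b + 1[ onto [phi b, phi b + 1[ in order. *)
Lemma passages_transport b : passages g (phi b) = map phi (passages g' b).
Proof.
have window t : phi b <= phi t < phi b + 1 = (b <= t < b + 1).
  by rewrite -(reparam_shift reparam_phi) reparam_leE reparam_ltE.
have [fin|inf] := pselect (finite_set [set u | b <= u < b + 1 /\ double_param g' u]).
  apply: passages_eq.
    rewrite sorted_map (eq_sorted (e' := <%R)) ?sorted_passages // => t u.
    exact: reparam_ltE.
  move=> y; split=> [/mapP[t /(mem_passages _ fin)[tb Dt] ->]|[]].
    by rewrite window; split=> //; apply/double_param_transport.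
  have [t <-] := reparam_surj y; rewrite window => tb Dt.
  apply: map_f; apply/(mem_passages _ fin); split=> //.
  exact/double_param_transport.
rewrite !passages_infinite // => fin; apply: inf.
rewrite (_ : mkset _ = phi @^-1` [set u | phi b <= u < phi b + 1 /\ double_param g u]).
  by apply: finite_preimage => // t u _ _; exact: reparam_inj.
by apply/seteqP; split=> t /=; rewrite window => -[tb /double_param_transport].
Qed.

End Reparam.

(** Both tangent vectors at A are transformed by the same jacobian matrix, of
    positive determinant, and rescaled by positive factors. *)
Lemma double_point_sign_transport (H : R -> plane -> plane) (phi : R -> R)
    (g g' : R -> plane) b :
    plane_isotopy H -> circle_reparam phi -> plane_closed_curve g ->
    injective (H 1) -> (forall t, g' t = H 1 (g (phi t))) ->
  {in gauss_word g (phi b), forall A,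
    double_point_sign g' b (H 1 A) = double_point_sign g (phi b) A}.
Proof.
move=> isoH rep curve_g inj_H g'E A; rewrite /gauss_word /double_point_sign.
have pE := passages_transport rep inj_H g'E b.
have [fin|inf] := pselect
  (finite_set [set u | phi b <= u < phi b + 1 /\ double_param g u]); last first.
  by move=> /mapP[t0 t0p _]; exfalso; move: t0p; rewrite (passages_infinite inf).
move=> /mapP[t0 t0p ->]; have := twice_passages curve_g fin t0p.
rewrite pE count_map filter_map -size_filter.
set q := [seq t <- _ | preim _ _ _] => size_q.
have -> : [seq t <- passages g' b | g' t == H 1 (g t0)] = q.
  by apply: eq_filter => t /=; rewrite g'E (inj_eq inj_H).
have [t [u [-> gt gu]]] : exists t u,
    [/\ q = [:: t; u], g (phi t) = g t0 & g (phi u) = g t0].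
  have : all (fun t => g (phi t) == g t0) q by exact: filter_all.
  case: q size_q => [|t [|u [|]]] //= _ /and3P[/eqP gt /eqP gu _].
  by exists t, u.
rewrite /=.
rewrite !(derive1_isotopic isoH curve_g rep g'E) gt gu.
rewrite frame_det_scale frame_det_mulmx !sgzM.
rewrite !(gtr0_sgz (reparam_increasing rep _)).
by rewrite (gtr0_sgz (det_jacobian_gt0 isoH _)) !mul1r.
Qed.

Lemma curve_pairing_transport (H : R -> plane -> plane) (phi : R -> R)
    (g g' : R -> plane) c b :
    plane_isotopy H -> circle_reparam phi -> plane_closed_curve g ->
    (forall t, g' t = H 1 (g (phi t))) ->
  curve_pairing g' c b = curve_pairing g c (phi b).
Proof.
move=> isoH rep curve_g g'E.
have [H' [HK _ _ _]] := isotopy_diffeo isoH (@unit_itv1 R).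
rewrite /curve_pairing /pairing_lin.
have -> : gauss_word g' b = map (H 1) (gauss_word g (phi b)).
  rewrite /gauss_word (passages_transport rep (can_inj HK) g'E) -!map_comp.
  exact: eq_map.
have signE := double_point_sign_transport isoH rep curve_g (can_inj HK) g'E.
apply: eq_bigr => p _; apply: (congr1 (GRing.mul p.1)).
exact: (pairing_map p.2 HK (signE b)).
Qed.

End Invariance.

Theorem theorem3p2 (R : realType) (s t : R) :
  (forall (g : R -> 'rV[R]_2) (b b' : R),
     plane_closed_curve g -> base_point g b -> base_point g b' ->
     CI3 s t g b = CI3 s t g b') /\
  (forall (g g' : R -> 'rV[R]_2) (b b' : R),
     plane_closed_curve g -> plane_closed_curve g' ->
     base_point g b -> base_point g' b' ->
     plane_isotopic g g' ->
     CI3 s t g b = CI3 s t g' b').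
Proof.
have CI3E g b : CI3 s t g b =
    s * (curve_pairing g bracket_XYXYZZ b)%:~R
    + t * (curve_pairing g bracket_XXYYZZ b)%:~R + (rotation_index g)%:~R by [].
have base (g : R -> 'rV[R]_2) b b' : plane_closed_curve g ->
    CI3 s t g b = CI3 s t g b'.
  move=> curve_g; rewrite !CI3E.
  rewrite (curve_pairing_base curve_g b b' alternating_XYXYZZ).
  by rewrite (curve_pairing_base curve_g b b' alternating_XXYYZZ).
split=> [g b b' curve_g _ _|g g' b b' curve_g _ _ _ [H [phi [isoH rep g'E]]]].
  exact: base.
rewrite (base g b (phi b') curve_g) !CI3E.
rewrite !(curve_pairing_transport _ _ isoH rep curve_g g'E).
by rewrite (rotation_index_isotopic isoH curve_g rep g'E).
Qed.
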